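(* Let $K$ be a finite simplicial complex and let $f_0,f_1:K\to\mathbb{R}$ be two functions, each assigning a (finite) real value to every simplex of $K$, such that for every $\alpha\in\mathbb{R}$ the sublevel sets $f_0^{-1}(-\infty,\alpha]$ and $f_1^{-1}(-\infty,\alpha]$ are simplicial complexes. Then $$d_B(\mathrm{Dgm}(f_0),\mathrm{Dgm}(f_1))\le \|f_0-f_1\|_\infty,$$ where $d_B$ denotes the bottleneck distance and $\|f_0-f_1\|_\infty=\max_{\sigma\in K}|f_0(\sigma)-f_1(\sigma)|$.
   Context: Here $K$ is regarded as its finite set of (nonempty) simplices. A sublevel set $f^{-1}(-\infty,\alpha]=\{\sigma\in K: f(\sigma)\le\alpha\}$ being a simplicial complex means that it is closed under taking faces (it may be empty). Persistence diagram. Fix a coefficient field. Given $f:K\to\mathbb{R}$ whose sublevel sets are all simplicial complexes, order the simplices of $K$ totally by increasing value of $f$; simplices with equal value are ordered by increasing dimension, and simplices with equal value and equal dimension are ordered arbitrarily. Write the order as $\sigma_1,\dots,\sigma_n$ and let $D$ be the $n\times n$ simplicial boundary matrix in this order. The standard persistence algorithm reduces $D$ by adding multiples of columns to columns further right until any two distinct nonzero columns have their lowest nonzero entries in distinct rows. It returns the list of all pairs $(\sigma,\tau)=(\sigma_i,\sigma_j)$ such that column $j$ of the reduced matrix is nonzero with lowest nonzero entry in row $i$. The diagram $\mathrm{Dgm}(f)$ is the multiset of points, exactly one point $p$ for each returned pair $(\sigma,\tau)$ (all dimensions together), with birth time $b(p)=f(\sigma)$ ($x$-coordinate) and death time $d(p)=f(\tau)$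 ($y$-coordinate). Points are taken with multiplicity, and points on the diagonal ($b(p)=d(p)$) are included. The multiset $\mathrm{Dgm}(f)$ does not depend on how ties are broken, and the number of its points depends only on $K$, not on $f$. Bottleneck distance. For two functions $f,g:K\to\mathbb{R}$ such that for every $\alpha\in\mathbb{R}$ the sublevel sets $f^{-1}(-\infty,\alpha]$ and $g^{-1}(-\infty,\alpha]$ are simplicial complexes, $$d_B(\mathrm{Dgm}(f),\mathrm{Dgm}(g))=\inf_{\pi}\ \max_{p\in\mathrm{Dgm}(f)}\ \max\{|b(p)-b(\pi(p))|,\ |d(p)-d(\pi(p))|\},$$ where the infimum is over all bijections $\pi:\mathrm{Dgm}(f)\to\mathrm{Dgm}(g)$ of multisets (no additional diagonal points are added); the maximum over an empty diagram is $0$. *)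

(* Defs.v *)
From HB Require Import structures.
From mathcomp Require Import all_boot all_order all_algebra.
From mathcomp Require Import boolp classical_sets reals constructive_ereal ereal.
Set Implicit Arguments.
Unset Strict Implicit.
Unset Printing Implicit Defensive.
Import Order.TTheory GRing.Theory Num.Theory.
Local Open Scope ring_scope.

(** Simplices are nonempty; the empty complex is allowed, and an element of [V]
    need not be a vertex of the complex. *)
Definition simplicial_complex (V : finType) (K : {set {set V}}) : Prop :=
  finset.set0 \notin K /\
  (forall s t : {set V}, s \in K -> t \subset s -> t != finset.set0 -> t \in K).

Notation simplex K := {s | s \in K}.

Definition dim (V : finType) (s : {set V}) : nat := #|s|.-1.

Definition sublevel (R : realType) (V : finType) (K : {set {set V}})
    (f : simplex K -> R) (alpha : R) : {set {set V}} :=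
  [set val s | s : simplex K & f s <= alpha]%SET.

(** The sequence [o 0, o 1, ...] lists every simplex once, by increasing value
    of [f] and then by increasing dimension; remaining ties are arbitrary. *)
Definition filtration_order (R : realType) (V : finType) (K : {set {set V}})
    (f : simplex K -> R) (o : 'I_#|{: simplex K}| -> simplex K) : Prop :=
  bijective o /\
  (forall i j : 'I_#|{: simplex K}|, (i < j)%N ->
     f (o i) < f (o j) \/
     f (o i) = f (o j) /\ (dim (val (o i)) <= dim (val (o j)))%N).

(** Column [j] is the boundary of [o j]: the facet omitting the vertex [v] has
    coefficient (-1)^p, where [p] is the position of [v] in [o j] for the fixed
    order [enum V].  The empty face of a vertex is not in [K], so the boundary
    of a vertex is 0. *)
Definition boundary_mx (F : fieldType) (V : finType) (K : {set {set V}})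
    (o : 'I_#|{: simplex K}| -> simplex K) : 'M[F]_#|{: simplex K}| :=
  \matrix_(i, j) \sum_(v in val (o j) | val (o i) == (val (o j) :\ v)%SET)
                    (-1) ^+ index v (enum (val (o j))).

Definition add_column (F : fieldType) (n : nat) (A : 'M[F]_n) (c : F)
    (i j : 'I_n) : 'M[F]_n :=
  \matrix_(k, l) if l == j then A k j + c * A k i else A k l.

Inductive column_reduces (F : fieldType) (n : nat) (A : 'M[F]_n) :
    'M[F]_n -> Prop :=
| column_reduces_refl : column_reduces A A
| column_reduces_step (B : 'M[F]_n) (c : F) (i j : 'I_n) :
    column_reduces A B -> (i < j)%N -> column_reduces A (add_column B c i j).

Definition is_low (F : fieldType) (n : nat) (A : 'M[F]_n) (i j : 'I_n) : bool :=
  (A i j != 0) && [forall k : 'I_n, (i < k)%N ==> (A k j == 0)].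

Definition reduced (F : fieldType) (n : nat) (A : 'M[F]_n) : Prop :=
  forall i j j' : 'I_n, is_low A i j -> is_low A i j' -> j = j'.

(** [D] lists, with multiplicity, the points of a persistence diagram of [f]
    with coefficients in [F].  The order of the simplices and the sequence of
    column additions are not prescribed, so [Dgm(f)] is a relation; lists that
    are permutations of each other are the same multiset. *)
Definition is_Dgm (F : fieldType) (R : realType) (V : finType)
    (K : {set {set V}}) (f : simplex K -> R) (D : seq (R * R)) : Prop :=
  exists (o : 'I_#|{: simplex K}| -> simplex K) (M : 'M[F]_#|{: simplex K}|),
    [/\ filtration_order f o,
        column_reduces (boundary_mx F o) M,
        reduced M
      & perm_eq D
          [seq (f (o ij.1), f (o ij.2)) |
             ij <- enum [set ij : 'I_#|{: simplex K}| * 'I_#|{: simplex K}| |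
                           is_low M ij.1 ij.2]%SET]].

(** Points of a diagram are addressed by their position in the list, so that
    repeated points stay distinct. *)
Definition matching_cost (R : realType) (D E : seq (R * R))
    (p : 'I_(size D) -> 'I_(size E)) : R :=
  \big[Num.max/0]_(i < size D)
    Num.max `|(tnth (in_tuple D) i).1 - (tnth (in_tuple E) (p i)).1|
            `|(tnth (in_tuple D) i).2 - (tnth (in_tuple E) (p i)).2|.

(** The infimum is taken in the extended reals, so that it is [+oo], and not a
    default real value, if there is no bijection. *)
Definition bottleneck (R : realType) (D E : seq (R * R)) : \bar R :=
  ereal_inf [set x : \bar R | exists p : 'I_(size D) -> 'I_(size E),
                bijective p /\ x = (matching_cost p)%:E]%classic.

Definition sup_dist (R : realType) (V : finType) (K : {set {set V}})
    (f g : simplex K -> R) : R :=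
  \big[Num.max/0]_(s : simplex K) `|f s - g s|.

Lemma filtration_order_exists (R : realType) (V : finType) (K : {set {set V}})
    (f : simplex K -> R) : exists o, filtration_order f o.
Proof.
pose r (s t : simplex K) := (f s < f t) ||
  ((f s == f t) && (dim (val s) <= dim (val t))%N).
have rtot : total r.
  move=> s t; rewrite /r; case: (ltgtP (f s) (f t)) => //= _.
  exact: leq_total.
have rtr : transitive r.
  move=> t s u; rewrite /r => /orP[h1|/andP[/eqP-> d1]] /orP[h2|/andP[/eqP<- d2]].
  - by rewrite (lt_trans h1 h2).
  - by rewrite h1.
  - by rewrite h2.
  - by rewrite eqxx (leq_trans d1 d2) orbT.
pose l := sort r (enum {: simplex K}).
have sl : size l = #|{: simplex K}| by rewrite size_sort -cardE.
have ul : uniq l by rewrite sort_uniq enum_uniq.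
have nl s : s \in l by rewrite mem_sort mem_enum.
case: (posnP #|{: simplex K}|) => [n0|npos].
  have e0 (i : 'I_#|{: simplex K}|) : False by have := ltn_ord i; rewrite [X in (_ < X)%N]n0.
  exists (fun i => match e0 i return simplex K with end); split=> [|i]; last by case: (e0 i).
  have k0 (s : simplex K) : False by have := card0_eq n0 s.
  by exists (fun s => match k0 s return 'I_#|{: simplex K}| with end)
    => [i|s]; [case: (e0 i)|case: (k0 s)].
have s0 : simplex K by move/card_gt0P/xchoose: (npos).
exists (fun i => nth s0 l i); split.
  have ltl s : (index s l < #|{: simplex K}|)%N by rewrite -sl index_mem.
  exists (fun s => Ordinal (ltl s)) => [i|s]; last by rewrite /= nth_index.
  by apply: val_inj; rewrite /= index_uniq ?sl.
move=> i j ij.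
have srt : sorted r l by exact: sort_sorted.
have := sorted_ltn_nth rtr s0 srt i j.
rewrite !inE !sl !ltn_ord => /(_ isT isT ij) /orP[h|/andP[/eqP h d]]; first by left.
by right.
Qed.

Lemma column_reduces_trans (F : fieldType) (n : nat) (A B C : 'M[F]_n) :
  column_reduces A B -> column_reduces B C -> column_reduces A C.
Proof. by move=> hAB; elim=> // *; apply: column_reduces_step. Qed.

Lemma reduction_exists (F : fieldType) (n : nat) (A : 'M[F]_n) :
  exists M, column_reduces A M /\ reduced M.
Proof.
pose red k (M : 'M[F]_n) := forall i j j' : 'I_n, (j < k)%N -> (j' < k)%N ->
  is_low M i j -> is_low M i j' -> j = j'.
suff H k : (k <= n)%N -> exists M, column_reduces A M /\ red k M.
  by have [M [hM rM]] := H n (leqnn n); exists M; split=> // i j j'; apply: rM.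
elim: k => [_|k IH kn]; first by exists A; split; [constructor|].
have [M [hM rM]] := IH (ltnW kn).
pose kk := Ordinal kn.
suff H' r (B : 'M[F]_n) : red k B ->
    (forall i : 'I_n, (r <= i)%N -> B i kk = 0) ->
    exists C, column_reduces B C /\ red k.+1 C.
  have [i|C [hC rC]] := H' n M rM; first by rewrite leqNgt ltn_ord.
  by exists C; split=> //; apply: column_reduces_trans hC.
have fin (C : 'M[F]_n) : red k C ->
    (forall i (j : 'I_n), (j < k)%N -> is_low C i j -> is_low C i kk -> False) ->
    red k.+1 C.
  move=> rB h i j j'; rewrite !ltnS [(j <= k)%N]leq_eqVlt [(j' <= k)%N]leq_eqVlt.
  move=> /orP[/eqP jk|jk] /orP[/eqP jk'|jk'] lj lj'.
  - by apply: val_inj; rewrite /= jk jk'.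
  - by have e : j = kk; [exact: val_inj|subst j; case: (h i j')].
  - by have e : j' = kk; [exact: val_inj|subst j'; case: (h i j)].
  - exact: (rB i).
elim: r B => [|r IHr] B rB zB.
  exists B; split; first by constructor.
  by apply: fin => // i j _ _ /andP[]; rewrite zB ?eqxx.
case: (ltnP r n) => [rn|nr]; last first.
  by apply: IHr => // i ri; move: (ltn_ord i); rewrite ltnNge (leq_trans nr ri).
pose rr := Ordinal rn.
have [B0|B0] := eqVneq (B rr kk) 0.
  apply: IHr => // i; rewrite leq_eqVlt => /orP[/eqP e|]; last exact: zB.
  by have -> : i = rr by exact: val_inj.
have lowk i : is_low B i kk -> i = rr.
  move=> /andP[nz /forallP z]; apply: val_inj => /=.
  apply/eqP; rewrite eqn_leq; apply/andP; split.
    by rewrite leqNgt; apply/negP => /zB e; rewrite e eqxx in nz.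
  by rewrite leqNgt; apply/negP => h; move: (z rr); rewrite /= h (negbTE B0).
case: (pickP (fun j : 'I_n => (j < k)%N && is_low B rr j)) => [j /andP[jk lj]|no].
  pose B' := add_column B (- (B rr kk / B rr j)) j kk.
  have same i (l : 'I_n) : (l < k)%N -> B' i l = B i l.
    move=> lk; rewrite mxE; case: eqP => // e.
    by move: lk; rewrite e ltnn.
  have slow i (l : 'I_n) : (l < k)%N -> is_low B' i l = is_low B i l.
    move=> lk; rewrite /is_low same //; congr (_ && _).
    by apply: eq_forallb => x; rewrite same.
  have [||C [hC rC]] := IHr B'.
  - by move=> i l l' lk lk'; rewrite !slow //; apply: rB.
  - move=> i; move: lj => /andP[nz /forallP z].
    rewrite mxE eqxx leq_eqVlt => /orP[/eqP e|ri].
      have -> : i = rr by exact: val_inj.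
      by rewrite mulNr divfK // subrr.
    by rewrite zB // (eqP (implyP (z i) ri)) mulr0 addr0.
  exists C; split=> //; apply: column_reduces_trans hC.
  by apply: column_reduces_step => //; constructor.
exists B; split; first by constructor.
apply: fin => // i j jk lj /lowk e; subst i.
by move: (no j); rewrite jk lj.
Qed.

Lemma Dgm_exists (F : fieldType) (R : realType) (V : finType)
    (K : {set {set V}}) (f : simplex K -> R) : exists D, is_Dgm F f D.
Proof.
have [o ho] := filtration_order_exists f.
have [M [hM rM]] := reduction_exists (boundary_mx F o).
by eexists; exists o, M; split; [exact: ho|exact: hM|exact: rM|exact: perm_refl].
Qed.

(* Main.v *)
Require Import Defs.
From mathcomp Require Import all_boot all_order all_algebra.
From mathcomp Require Import boolp reals constructive_ereal ereal.
From mathcomp Require Import perm lra.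
Import Order.TTheory GRing.Theory Num.Theory.

(** Fix the total orders [o0], [o1] of the simplices and the reduced matrices
    [M0], [M1] that produce the two diagrams.  The proof inserts a third,
    mixed matrix: the boundary matrix with its rows ordered by [o0] and its
    columns by [o1], reduced to some [M].  Two min-max principles control what
    happens when only one of the two orders is changed.

    - Columns change, rows stay.  In a reduced matrix the low entries of the
      nonzero columns are distinct, so a linear combination of columns has as
      its low entry the largest of those of the columns used.  Hence row [i]
      is paired exactly when some combination of columns has its low entry in
      row [i], and the value of its partner is the minimum, over all such
      combinations, of the largest column value used.  This minimum is
      1-Lipschitz in the column values ([low_change_columns]).
    - Rows change, columns stay.  Column [j] is paired exactly when it is not
      a combination of earlier columns, and the value of its partner is the
      minimum, over all vectors obtained from column [j] by adding earlier
      columns, of the largest row value in the support.  This minimum is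
      1-Lipschitz in the row values ([low_change_rows]).

    Thus the pairs of [M0] and of [M] correspond by equality of the row index,
    and those of [M] and [M1] by equality of the column index.  In the
    composite bijection from the pairs of [M0] to those of [M1] the first step
    moves only the death time and the second only the birth time, each by at
    most the sup distance of the two functions. *)

Set Implicit Arguments.
Unset Strict Implicit.
Unset Printing Implicit Defensive.
Local Open Scope ring_scope.

(** * Column operations as unitriangular factors *)

Definition upper_unitriangular (F : fieldType) (n : nat) (U : 'M[F]_n) : Prop :=
  forall k l : 'I_n, (l <= k)%N -> U k l = (k == l)%:R.

Lemma upper_unitriangular_mul (F : fieldType) (n : nat) (U W : 'M[F]_n) :
  upper_unitriangular U -> upper_unitriangular W ->
  upper_unitriangular (U *m W).
Proof.
move=> hU hW k l lk; rewrite mxE.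
have z (m : 'I_n) : m != k -> U k m * W m l = 0.
  move=> mk; case: (leqP m k) => [le|lt].
    by rewrite hU // eq_sym (negbTE mk) mul0r.
  rewrite hW; last exact: leq_trans lk (ltnW lt).
  by rewrite -val_eqE gtn_eqF ?mulr0 //; exact: leq_ltn_trans lk lt.
rewrite (bigD1 k) //= big1 ?addr0; last by move=> m mk; exact: z.
by rewrite hU // eqxx mul1r hW.
Qed.

(** Both factors are kept because the min-max principles express columns of the
    original matrix through the reduced one as well as conversely.  Column
    additions go from left to right, which makes the factors triangular: they
    preserve the span of every initial segment of columns. *)
Lemma column_reduces_unitriangular (F : fieldType) (n : nat) (A M : 'M[F]_n) :
  column_reduces A M ->
  exists U W : 'M[F]_n, [/\ upper_unitriangular U, upper_unitriangular W,
    M = A *m U & A = M *m W].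
Proof.
have h1 : upper_unitriangular (1%:M : 'M[F]_n) by move=> k l _; rewrite mxE.
have hE (c : F) (i j : 'I_n) : (i < j)%N ->
    upper_unitriangular (1%:M + c *: delta_mx i j).
  move=> ij k l lk; rewrite !mxE; case: andP => [[/eqP ek /eqP el]|_].
    by rewrite ek el leqNgt ij in lk.
  by rewrite mulr0 addr0.
elim=> [|B c i j _ [U [W [hU hW eB eA]]] ij].
  by exists 1%:M, 1%:M; rewrite !mulmx1.
have eadd : add_column B c i j = B *m (1%:M + c *: delta_mx i j).
  apply/matrixP=> k l; rewrite mulmxDr mulmx1 -scalemxAr !mxE (bigD1 i) //=.
  rewrite mxE eqxx big1 ?addr0 => [|m mi]; last first.
    by rewrite mxE (negbTE mi) mulr0.
  by case: eqP => [->|_] /=; rewrite ?mulr1 ?mulr0 ?addr0.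
exists (U *m (1%:M + c *: delta_mx i j)), ((1%:M + (- c) *: delta_mx i j) *m W).
split.
- by apply: upper_unitriangular_mul => //; exact: hE.
- by apply: upper_unitriangular_mul => //; exact: hE.
- by rewrite eadd eB mulmxA.
rewrite eadd {1}eA mulmxA -(mulmxA B); congr (_ *m _).
rewrite mulmxDr mulmx1 mulmxDl mul1mx -scalemxAl -scalemxAr mul_delta_mx_0.
  by rewrite !scaler0 addr0 scaleNr addrK mulmx1.
by rewrite -val_eqE gtn_eqF.
Qed.

(** * Low entries of combinations of reduced columns *)

Lemma is_low_uniq (F : fieldType) (n : nat) (M : 'M[F]_n) (i i' j : 'I_n) :
  is_low M i j -> is_low M i' j -> i = i'.
Proof.
move=> /andP[nz /forallP z] /andP[nz' /forallP z']; apply: val_inj => /=.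
case: (ltngtP i i') => // lt.
  by move: (implyP (z i') lt); rewrite (negbTE nz').
by move: (implyP (z' i) lt); rewrite (negbTE nz).
Qed.

Lemma is_low_above (F : fieldType) (n : nat) (M : 'M[F]_n) (i j : 'I_n) :
  M i j != 0 -> exists2 i' : 'I_n, (i <= i')%N & is_low M i' j.
Proof.
move=> nz.
case: (@arg_maxnP _ i (fun i' => M i' j != 0) val nz) => i' nz' max.
exists i'; first exact: max.
rewrite /is_low nz'; apply/forallP=> k; apply/implyP; apply: contraTT => nk.
by rewrite -leqNgt; exact: max.
Qed.

(** Cancellation cannot lower the low entry of a combination of reduced
    columns: among the columns used, the one whose low entry is lowest in the
    matrix is alone in reaching that row. *)
Lemma reduced_mul_low (F : fieldType) (n : nat) (M : 'M[F]_n) (x : 'cV[F]_n)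
    (i0 j0 : 'I_n) : reduced M -> x j0 0 != 0 -> is_low M i0 j0 ->
  exists i j : 'I_n, [/\ (i0 <= i)%N, x j 0 != 0, is_low M i j,
    (M *m x) i 0 != 0 & forall k : 'I_n, (i < k)%N -> (M *m x) k 0 = 0].
Proof.
move=> redM x0 low0.
pose P (p : 'I_n * 'I_n) := (x p.2 0 != 0) && is_low M p.1 p.2.
have P0 : P (i0, j0) by rewrite /P x0.
(* the pair attaining the low entry: largest row among the columns used *)
case: (@arg_maxnP _ (i0, j0) P (fun p => val p.1) P0) => -[i j] /andP[/= xj low] max.
have top (k l : 'I_n) : x l 0 != 0 -> M k l != 0 ->
    exists i' : 'I_n, [/\ (k <= i')%N, (i' <= i)%N & is_low M i' l].
  move=> xl /is_low_above[i' ki' low']; exists i'; split=> //.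
  by apply: (max (i', l)); rewrite /P /= xl.
exists i, j; split=> //; first exact: (max (i0, j0)).
  rewrite mxE (bigD1 j) //= big1 ?addr0 => [|l lj].
    by rewrite mulf_neq0 //; case/andP: low.
  apply/eqP; apply: contraNT lj; rewrite mulf_eq0 negb_or => /andP[Mil xl].
  have [i' [le ge low']] := top _ _ xl Mil.
  have e : i' = i by apply: val_inj; apply/eqP; rewrite eqn_leq ge.
  by rewrite e in low'; apply/eqP; exact: (redM _ _ _ low' low).
move=> k ik; rewrite mxE big1 // => l _.
apply/eqP; apply: contraLR ik; rewrite mulf_eq0 negb_or => /andP[Mkl xl].
have [i' [le ge _]] := top _ _ xl Mkl.
by rewrite -leqNgt (leq_trans le).
Qed.

(** * Changing the order of the columns or of the rows *)

Definition indexed_mx (F : fieldType) (S T : Type) (B : S -> T -> F) (n : nat)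
  (r : 'I_n -> S) (c : 'I_n -> T) : 'M[F]_n := \matrix_(i, j) B (r i) (c j).

(** The reduced column [j0] of [M0] is a combination of original columns at
    positions at most [j0], whose values exceed that of [j0] nowhere.  Written
    in the second order and then through the reduced columns of [M1], the same
    vector must use the column of [M1] with low entry in row [i], and that
    column precedes some column of the original combination. *)
Lemma low_change_columns (F : fieldType) (R : realType) (S T : Type)
    (B : S -> T -> F) (n : nat) (r : 'I_n -> S) (c0 c1 : 'I_n -> T)
    (f0 f1 : T -> R) (e : R) (M0 M1 : 'M[F]_n) (i j0 : 'I_n) :
  bijective c0 -> bijective c1 ->
  {homo f0 \o c0 : j j' / (j <= j')%N >-> j <= j'} ->
  {homo f1 \o c1 : j j' / (j <= j')%N >-> j <= j'} ->
  (forall t, f1 t <= f0 t + e) ->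
  column_reduces (indexed_mx B r c0) M0 ->
  column_reduces (indexed_mx B r c1) M1 -> reduced M1 ->
  is_low M0 i j0 ->
  exists2 j1, is_low M1 i j1 & f1 (c1 j1) <= f0 (c0 j0) + e.
Proof.
move=> [d0 c0K d0K] bc1 mono0 mono1 close.
move=> /column_reduces_unitriangular[U [_ [hU _ e0 _]]].
move=> /column_reduces_unitriangular[_ [W [_ hW _ e1]]] red1 low0.
(* [s] sends positions in the second order to positions in the first; [y]
   writes column [j0] of [M0] in terms of the columns of [M1] *)
pose s := d0 \o c1.
have bs : bijective s.
  by apply: bij_comp => //; exists c0.
pose x : 'cV[F]_n := \col_j U (s j) j0.
pose y := W *m x.
have My k : (M1 *m y) k 0 = M0 k j0.
  rewrite /y mulmxA -e1 e0 !mxE [RHS](reindex s) /=; last exact: onW_bij.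
  by apply: eq_bigr => l _; rewrite !mxE /s /= d0K.
case/andP: (low0) => nz /forallP z.
have [j yj Mj] : exists2 j, y j 0 != 0 & M1 i j != 0.
  apply: contrapT => no; move/eqP: nz; apply; rewrite -My mxE big1 // => j _.
  apply/eqP; rewrite mulf_eq0; apply: contrapT => /negP; rewrite negb_or.
  by case/andP=> ? ?; apply: no; exists j.
have [i0 _ lowi0] := is_low_above Mj.
have [i1 [j1 [_ yj1 low1 nz1 z1]]] := reduced_mul_low red1 yj lowi0.
have ei : i1 = i.
  apply: val_inj => /=; case: (ltngtP i1 i) => // lt.
    by move: nz; rewrite -My z1 ?eqxx.
  by move: nz1; rewrite My (eqP (implyP (z i1) lt)) eqxx.
exists j1; first by rewrite -ei.
(* [W] is upper triangular, so [y] can use [j1] only if [x] uses some column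
   at or after it *)
have [k jk xk] : exists2 k : 'I_n, (j1 <= k)%N & x k 0 != 0.
  apply: contrapT => no; move/eqP: yj1; apply; rewrite mxE big1 // => k _.
  case: (leqP j1 k) => [le|lt]; last by rewrite hW ?(ltnW lt) // -val_eqE gtn_eqF ?mul0r.
  apply/eqP; rewrite mulf_eq0; apply/orP; right; apply: contrapT => /negP ?.
  by apply: no; exists k.
have sk : (s k <= j0)%N.
  rewrite leqNgt; apply: contra xk => lt.
  by rewrite mxE hU ?(ltnW lt) // -val_eqE gtn_eqF.
apply: (le_trans (mono1 _ _ jk)); apply: (le_trans (close _)) => /=.
by rewrite lerD2r; have := mono0 _ _ sk; rewrite /s /= d0K.
Qed.

(** Column [j] of [M0] is column [j] of the original matrix plus earlier ones.
    With its rows permuted it is a combination of columns of [M1] in which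
    column [j] occurs, so its low entry in the second order is at or below that
    of column [j] of [M1].  The row [k] of that entry lies in the support of
    column [j] of [M0], hence has value at most that of [i0]. *)
Lemma low_change_rows (F : fieldType) (R : realType) (S T : Type)
    (B : S -> T -> F) (n : nat) (r0 r1 : 'I_n -> S) (c : 'I_n -> T)
    (f0 f1 : S -> R) (e : R) (M0 M1 : 'M[F]_n) (i0 j : 'I_n) :
  bijective r0 -> bijective r1 ->
  {homo f0 \o r0 : i i' / (i <= i')%N >-> i <= i'} ->
  {homo f1 \o r1 : i i' / (i <= i')%N >-> i <= i'} ->
  (forall s, f1 s <= f0 s + e) ->
  column_reduces (indexed_mx B r0 c) M0 -> reduced M0 ->
  column_reduces (indexed_mx B r1 c) M1 -> reduced M1 ->
  is_low M0 i0 j ->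
  exists2 i1, is_low M1 i1 j & f1 (r1 i1) <= f0 (r0 i0) + e.
Proof.
move=> [q0 r0K q0K] [q1 r1K q1K] mono0 mono1 close.
move=> /column_reduces_unitriangular[U0 [W0 [hU0 hW0 e0 e0']]] red0.
move=> /column_reduces_unitriangular[U1 [W1 [hU1 hW1 e1 e1']]] red1 low0.
have diag (U W : 'M[F]_n) : upper_unitriangular U -> upper_unitriangular W ->
    (col j (W *m U)) j 0 != 0.
  by move=> hU hW; rewrite mxE upper_unitriangular_mul // eqxx oner_neq0.
have mul_col (M X : 'M[F]_n) k : (M *m col j X) k 0 = (M *m X) k j.
  by rewrite !mxE; apply: eq_bigr => l _; rewrite mxE.
have eM01 k : (M0 *m col j (W0 *m U1)) k 0 = M1 (q1 (r0 k)) j.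
  rewrite mul_col mulmxA -e0' e1 !mxE; apply: eq_bigr => l _.
  by rewrite !mxE q1K.
have eM10 k : (M1 *m col j (W1 *m U0)) k 0 = M0 (q0 (r1 k)) j.
  rewrite mul_col mulmxA -e1' e0 !mxE; apply: eq_bigr => l _.
  by rewrite !mxE q0K.
(* column [j] of [M1] is nonzero, since it is a combination of columns of [M0]
   that uses the nonzero column [j] *)
have [k0 [_ [_ _ _ nz1 _]]] :=
  reduced_mul_low red0 (diag _ _ hU1 hW0) low0.
rewrite eM01 in nz1.
have [i1 _ low1] := is_low_above nz1.
exists i1 => //.
have [k [_ [ik _ _ nz0 _]]] :=
  reduced_mul_low red1 (diag _ _ hU0 hW1) low1.
rewrite eM10 in nz0.
have [i' ki' low'] := is_low_above nz0.
have ei : i' = i0 := is_low_uniq low' low0.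
rewrite ei in ki'.
apply: (le_trans (mono1 _ _ ik)); apply: (le_trans (close _)) => /=.
by rewrite lerD2r; have := mono0 _ _ ki'; rewrite /= q0K.
Qed.

(** The matching of pairs goes through a reduced mixed matrix [M]: a pair
    [(i0, j0)] of [M0] is matched to the pair [(i1, j1)] of [M1] for which
    [(i0, j1)] is a pair of [M].  The one-sided bounds above, used in both
    directions, give the two absolute values. *)
Lemma low_pairs_matching (F : fieldType) (R : realType) (T : Type)
    (B : T -> T -> F) (n : nat) (o0 o1 : 'I_n -> T) (f0 f1 : T -> R) (e : R)
    (M0 M1 : 'M[F]_n) :
  bijective o0 -> bijective o1 ->
  {homo f0 \o o0 : i j / (i <= j)%N >-> i <= j} ->
  {homo f1 \o o1 : i j / (i <= j)%N >-> i <= j} ->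
  (forall t, `|f0 t - f1 t| <= e) ->
  column_reduces (indexed_mx B o0 o0) M0 -> reduced M0 ->
  column_reduces (indexed_mx B o1 o1) M1 -> reduced M1 ->
  exists h : 'I_n * 'I_n -> 'I_n * 'I_n,
    perm_eq (enum [set p | is_low M1 p.1 p.2])
            (map h (enum [set p | is_low M0 p.1 p.2])) /\
    forall p, is_low M0 p.1 p.2 ->
      `|f0 (o0 p.1) - f1 (o1 (h p).1)| <= e /\
      `|f0 (o0 p.2) - f1 (o1 (h p).2)| <= e.
Proof.
move=> b0 b1 mono0 mono1 close c0 red0 c1 red1.
have [M [cM redM]] := reduction_exists (indexed_mx B o0 o1).
have close1 t : f1 t <= f0 t + e by have := close t; rewrite ler_norml => /andP[]; lra.
have close0 t : f0 t <= f1 t + e by have := close t; rewrite ler_norml => /andP[]; lra.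
pose rel (p q : 'I_n * 'I_n) := [/\ is_low M p.1 q.2,
  `|f0 (o0 p.1) - f1 (o1 q.1)| <= e & `|f0 (o0 p.2) - f1 (o1 q.2)| <= e].
have relI (p q : 'I_n * 'I_n) :
    is_low M0 p.1 p.2 -> is_low M p.1 q.2 -> is_low M1 q.1 q.2 -> rel p q.
  move=> low0 low low1; split=> //.
  - have [i1 l1 v1] := low_change_rows b0 b1 mono0 mono1 close1
      cM redM c1 red1 low.
    have [i2 l2 v2] := low_change_rows b1 b0 mono1 mono0 close0
      c1 red1 cM redM low1.
    rewrite (is_low_uniq l1 low1) in v1.
    rewrite (is_low_uniq l2 low) in v2.
    by rewrite ler_norml; apply/andP; split; lra.
  - have [j1 l1 v1] := low_change_columns b0 b1 mono0 mono1
      close1 c0 cM redM low0.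
    have [j2 l2 v2] := low_change_columns b1 b0 mono1 mono0
      close0 cM c0 red0 low.
    rewrite (redM _ _ _ l1 low) in v1.
    rewrite (red0 _ _ _ l2 low0) in v2.
    by rewrite ler_norml; apply/andP; split; lra.
have fwd p : exists q, is_low M0 p.1 p.2 -> is_low M1 q.1 q.2 /\ rel p q.
  case: (boolP (is_low M0 p.1 p.2)) => [low0|_]; last by exists p.
  have [j1 low _] := low_change_columns b0 b1 mono0 mono1
    close1 c0 cM redM low0.
  have [i1 low1 _] := low_change_rows b0 b1 mono0 mono1 close1
    cM redM c1 red1 low.
  by exists (i1, j1) => _; split=> //; exact: relI.
have bwd q : is_low M1 q.1 q.2 -> exists2 p, is_low M0 p.1 p.2 & is_low M p.1 q.2.
  move=> low1.
  have [i0 low _] := low_change_rows b1 b0 mono1 mono0 close0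
    c1 red1 cM redM low1.
  have [j0 low0 _] := low_change_columns b1 b0 mono1 mono0
    close0 cM c0 red0 low.
  by exists (i0, j0).
have [h hP] := choice fwd.
exists h; split; last by move=> p /hP[_ []].
rewrite perm_sym; apply: uniq_perm; last move=> q.
- rewrite map_inj_in_uniq ?enum_uniq // => -[i j] -[i' j'].
  rewrite !mem_enum !inE /= => low0 low0' eh.
  have [_ [/= l _ _]] := hP (i, j) low0; have [_ [/= l' _ _]] := hP (i', j') low0'.
  rewrite -eh in l'; have ei := is_low_uniq l l'; subst i'.
  by rewrite (red0 _ _ _ low0 low0').
- exact: enum_uniq.
rewrite mem_enum inE; apply/mapP/idP => [[p]|low1].
  by rewrite mem_enum inE => /hP[low1 _] ->.
have [p low0 low] := bwd q low1; exists p; first by rewrite mem_enum inE.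
have [low1' [low' _ _]] := hP p low0.
have e2 := redM _ _ _ low low'; rewrite -e2 in low1'.
case: q (h p) e2 low1 low1' {low low'} => i j [i' j'] /= <- l l'.
by rewrite (is_low_uniq l l').
Qed.

(** * From matched pairs to the bottleneck distance *)

Lemma perm_eq_index_bij (T : eqType) (x0 : T) (s t : seq T) : perm_eq s t ->
  exists2 p : 'I_(size s) -> 'I_(size t),
    bijective p & forall i : 'I_(size s), nth x0 s i = nth x0 t (p i).
Proof.
move=> st; have sz := perm_size st.
have /tuple_permP[p ep] : perm_eq s (in_tuple t) by [].
exists (p \o cast_ord sz).
  apply: bij_comp; first exact: injF_bij perm_inj.
  by exists (cast_ord (esym sz)); [exact: cast_ordK|exact: cast_ordKV].
move=> i; rewrite /= {1}ep (nth_map (cast_ord sz i)) ?size_enum_ord -?sz ?ltn_ord //.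
by rewrite (tnth_nth x0) /= (nth_ord_enum _ (cast_ord sz i)).
Qed.

(** Indexing both diagrams by one list [L] turns a matching into the identity
    of [L], up to the permutations hidden in the two multisets. *)
Lemma bottleneck_map_le (R : realType) (X : eqType) (L : seq X)
    (a b : X -> R * R) (e : R) (D E : seq (R * R)) :
  perm_eq D (map a L) -> perm_eq E (map b L) -> 0 <= e ->
  {in L, forall x, `|(a x).1 - (b x).1| <= e /\ `|(a x).2 - (b x).2| <= e} ->
  (bottleneck D E <= e%:E)%E.
Proof.
move=> pD pE e0 ab; rewrite perm_sym in pE.
have [p bp hp] := perm_eq_index_bij (0, 0) pD.
have [q bq hq] := perm_eq_index_bij (0, 0) pE.
have sz : size (map a L) = size (map b L) by rewrite !size_map.
pose m := q \o (cast_ord sz \o p).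
have bm : bijective m.
  apply: bij_comp => //; apply: bij_comp => //.
  by exists (cast_ord (esym sz)); [exact: cast_ordK|exact: cast_ordKV].
apply: (@le_trans _ _ (matching_cost m)%:E); first by apply: ereal_inf_lbound; exists m.
rewrite lee_fin; apply: bigmax_le => // i _.
rewrite !(tnth_nth (0, 0)) /= hp -hq /=.
have lt : (p i < size L)%N by rewrite -(size_map a) ltn_ord.
pose x0 := tnth (in_tuple L) (Ordinal lt).
rewrite !(nth_map x0) //; have [? ?] := ab _ (mem_nth x0 lt).
by rewrite ge_max; apply/andP.
Qed.

(** * Stability *)

Unset Implicit Arguments.

Theorem theorem1p1 (F : fieldType) (R : realType) (V : finType)
    (K : {set {set V}}) (hK : simplicial_complex K)
    (f0 f1 : simplex K -> R)
    (hf0 : forall alpha : R, simplicial_complex (sublevel f0 alpha))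
    (hf1 : forall alpha : R, simplicial_complex (sublevel f1 alpha))
    (D0 D1 : seq (R * R)) (hD0 : is_Dgm F f0 D0) (hD1 : is_Dgm F f1 D1) :
  (bottleneck D0 D1 <= (sup_dist f0 f1)%:E)%E.
Proof.
have [o0 [M0 [[bo0 ord0] red0 low0 pD0]]] := hD0.
have [o1 [M1 [[bo1 ord1] red1 low1 pD1]]] := hD1.
have mono (f : simplex K -> R) (o : 'I_#|{: simplex K}| -> simplex K) :
    filtration_order f o -> {homo f \o o : i j / (i <= j)%N >-> i <= j}.
  move=> [_ ord] i j; rewrite leq_eqVlt => /orP[/eqP/val_inj->|/ord[/ltW|[/= -> _]]] //.
pose B (s t : simplex K) : F := \sum_(v in val t | val s == (val t :\ v)%SET)
  (-1) ^+ index v (enum (val t)).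
have close s : `|f0 s - f1 s| <= sup_dist f0 f1 by exact: le_bigmax.
have [h [ph hP]] := @low_pairs_matching _ _ _ B _ _ _ _ _ _ _ _ bo0 bo1
  (mono _ _ (conj bo0 ord0)) (mono _ _ (conj bo1 ord1)) close red0 low0 red1 low1.
pose L := enum [set p | is_low M0 p.1 p.2].
apply: (@bottleneck_map_le _ _ L (fun p => (f0 (o0 p.1), f0 (o0 p.2)))
  (fun p => (f1 (o1 (h p).1), f1 (o1 (h p).2)))) => //.
- apply: perm_trans pD1 _.
  rewrite (map_comp (fun p => (f1 (o1 p.1), f1 (o1 p.2))) h).
  exact: perm_map.
- exact: bigmax_ge_id.
- by move=> p; rewrite mem_enum inE => /hP.
Qed.
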